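(* For all integers $r\ge 2$, $s\ge 1$ and $d\ge 2$, $$f_{r}(d,s,\ldots,s)>s^{\min\{r,d\}}.$$
   Context: A set in $\mathbb{R}^{d}$ is called $s$-convex if it is a union of at most $s$ convex sets. For integers $r\ge 2$, $d\ge 1$ and $s_{1},\ldots,s_{r}\ge 1$, let $f_{r}(d,s_{1},\ldots,s_{r})$ be the least integer $N$ with the following property: whenever $P\subseteq\mathbb{R}^{d}$ is finite and $|P|\ge N$, there is a partition $P=P_{1}\sqcup\cdots\sqcup P_{r}$ into nonempty parts such that every choice of $s_{i}$-convex sets $C_{i}\supseteq P_{i}$, $i\in[r]=\{1,\ldots,r\}$, satisfies $\bigcap_{i=1}^{r}C_{i}\ne\emptyset$. In $f_{r}(d,s,\ldots,s)$ the parameter $s$ is repeated $r$ times. *)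

(* Defs.v *)
From mathcomp Require Import all_boot all_order all_algebra finmap.
From mathcomp Require Import boolp classical_sets cardinality reals ereal convex.

Set Implicit Arguments.
Unset Strict Implicit.
Unset Printing Implicit Defensive.

Import Order.TTheory GRing.Theory Num.Theory.

Local Open Scope classical_set_scope.
Local Open Scope ring_scope.

Definition s_convex (R : realType) (d s : nat) (C : set 'rV[R]_d) : Prop :=
  exists k (D : 'I_k -> set 'rV[R]_d),
    [/\ (k <= s)%N, forall j, convex_set (D j) & C = \bigcup_j D j].

Definition s_convex_tverberg_partition (R : realType) (r d : nat)
    (s : 'I_r -> nat) (P : {fset 'rV[R]_d}) : Prop :=
  exists Q : 'I_r -> set 'rV[R]_d,
    partition [set: 'I_r] Q [set` P] /\
    forall C : 'I_r -> set 'rV[R]_d,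
      (forall i, s_convex (s i) (C i)) -> (forall i, Q i `<=` C i) ->
      \bigcap_i C i !=set0.

Definition s_convex_tverberg_property (R : realType) (r d : nat)
    (s : 'I_r -> nat) (N : nat) : Prop :=
  forall P : {fset 'rV[R]_d}, (N <= #|` P|)%N ->
    s_convex_tverberg_partition s P.

(* The number f_r(d, s_1, ..., s_r): the infimum of a nonempty set of integers
   is its least element, and it is +oo if no N has the property. *)
Definition s_convex_tverberg (R : realType) (r d : nat) (s : 'I_r -> nat) :
    \bar R :=
  ereal_inf [set N%:R%:E | N in s_convex_tverberg_property R d s].

(* Main.v *)
Require Import Defs.
From mathcomp Require Import all_boot all_order all_algebra.
From mathcomp Require Import reals ereal.
From mathcomp Require Import finmap boolp classical_sets convex.
From mathcomp Require Import ring lra.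

(** Put m = min(r, d).  Since f_r is the least good N and goodness passes to
larger N, it is enough to exhibit s^m points of R^d without the partition
property.  The points p_a are indexed by the words a of length m over an
alphabet of s letters.

The mechanism is a certificate for empty intersections
([no_tverberg_partition_of_normals]).  Suppose that every word a comes with m
normal vectors w_(a,1), ..., w_(a,m) of sum zero such that w_(a,k) is positive
on p_b - p_a for all words b <> a that agree with a at place k.  Given disjoint
sets P_1, ..., P_m of the points, cover P_k by s convex sets, one for each
letter j: the part of P_k whose k-th letter is j lies in the intersection of
the half-spaces with normal w_(a,k) bounded at p_a, over all a with k-th
letter j; the bounding hyperplane is included only when p_a is in P_k.  A point
v common to all the unions selects one letter for every k, hence a word a, and
v lies in the half-spaces of a for every k.  The normals having sum zero, v is
on all the bounding hyperplanes, so p_a is in every P_k; as m >= 2 this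
contradicts disjointness.

It remains to find such points.  A grid with slices near coordinate
hyperplanes does not help: in the plane, the hulls of a row and of a column
may cross even when their common point is left out of one of them.  Instead
the words are ordered as numbers in a large base B.  With digits
t_k = a_k B^k and partial sums X_k = t_0 + ... + t_(k-1), put x = X_m and
z_k = X_(k+1)^2 - X_k^2, so that the z_k add up to x^2.  For k < m the k-th
coordinate of p_a is x + x^2 - m z_k, and the other coordinates are zero; the
sum of the coordinates is m x, so x is a linear function of the point, and
  u_k(b) = (x_b - x_a)^2
           - m (z_k(b) - z_k(a) - 2 t_k(a) (x_b - x_a))
is an affine function of p_b.  These functions vanish at b = a and add up to
zero over k.  Their linear parts, times m, are the wanted normals
([point_normal], [sum_normal]).  When a and b agree at place k with digit t,
u_k reduces to
  (x_b - x_a)^2 + 2 m t ((x_b - x_a) - (X_k(b) - X_k(a))).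
If the top place where a and b differ is below k, the last bracket is zero; if
it is above k, then x_b - x_a is so much larger than t and X_k(b) - X_k(a)
that the square dominates.  Either way u_k(b) > 0 ([separation_gt0]). *)

Import Order.TTheory GRing.Theory Num.Theory.

Local Open Scope ring_scope.

(** * Certifying an empty intersection by normals of sum zero *)

Section Criterion.
Local Open Scope classical_set_scope.

(** Open and closed half-spaces together: whether the boundary belongs to the
half-space will depend on the partition. *)
Lemma convex_halfspace (R : realType) (d : nat) (w : 'cV[R]_d) (q : 'rV[R]_d)
    (b : bool) :
  convex_set [set v : 'rV[R]_d | 0 < ((v - q) *m w) 0 0 ?<= if b].
Proof.
apply/convex_setW => x y + + t t0 t1; rewrite !inE /= => hx hy.
set z := conv _ _ _.
have -> : ((z - q) *m w) 0 0 = t%:num * ((x - q) *m w) 0 0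
    + (1 - t%:num) * ((y - q) *m w) 0 0.
  rewrite [z](_ : _ = t%:num *: x + (1 - t%:num) *: y) //.
  by rewrite !mulmxBl mulmxDl -!scalemxAl !mxE; ring.
by case: b hx hy => /= hx hy; nra.
Qed.

(** The covering sets are unions of s intersections of half-spaces, indexed by
the value of the k-th letter; only the first m parts are covered this way, the
whole space serves for the others.  The boundary of a half-space at p a is kept
exactly when p a belongs to the part, so that a common point, being forced onto
every boundary, puts p a into all m parts. *)
Lemma no_tverberg_partition_of_normals (R : realType) (r s d m : nat)
    (p : {ffun 'I_m -> 'I_s} -> 'rV[R]_d)
    (w : {ffun 'I_m -> 'I_s} -> 'I_m -> 'cV[R]_d) (P : {fset 'rV[R]_d}) :
    (1 < m)%N -> (m <= r)%N -> (0 < s)%N ->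
    (forall v, v \in P -> exists a, v = p a) ->
    (forall a, \sum_k w a k = 0) ->
    (forall (a b : {ffun 'I_m -> 'I_s}) k, b k = a k -> b != a ->
      0 < ((p b - p a) *m w a k) 0 0) ->
  ~ s_convex_tverberg_partition (fun _ : 'I_r => s) P.
Proof.
move=> m_gt1 le_mr s_gt0 Pp w0 w_gt0 [Q [[QP Qdisj _] hQ]].
pose part (k : 'I_m) := Q (widen_ord le_mr k).
pose D k j := [set v | forall a : {ffun 'I_m -> 'I_s}, a k = j ->
  0 < ((v - p a) *m w a k) 0 0 ?<= if `[< part k (p a) >]].
pose C (i : 'I_r) := if insub (val i) is Some k then \bigcup_j D k j else setT.
have C_widen k : C (widen_ord le_mr k) = \bigcup_j D k j.
  by rewrite /C /= valK.
have [||v hv] := hQ C.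
- move=> i; rewrite /C; case: insub => [k|].
    exists s, (D k); split=> // j x y t; rewrite !inE => Dx Dy a ak.
    by apply/set_mem/(convex_halfspace R d (w a k) (p a));
      rewrite inE; [exact: Dx|exact: Dy].
  exists 1%N, (fun=> setT); split=> // [_ x y t|]; first by rewrite !in_setT.
  by apply/esym/seteqP; split=> // x _; exists ord0.
- move=> i v Qv; rewrite /C; case: insubP => [k _ ki|//].
  have /Pp[b vb] : v \in P by have : cover setT Q v by [exists i]; rewrite QP.
  have ik : i = widen_ord le_mr k by apply: val_inj; rewrite /= ki.
  exists (b k) => //= a ab; rewrite vb.
  have [<-|neq] := eqVneq b a; last first.
    by apply: lteifS; apply: w_gt0.
  rewrite subrr mul0mx mxE lteifxx; apply/asboolP.
  by rewrite /part -ik -vb.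
have Dv k : exists j, D k j v.
  by have := hv (widen_ord le_mr k) I; rewrite C_widen => -[j _]; exists j.
have [a Da] := choice Dv.
pose af := [ffun k => a k].
have Daf k : 0 < ((v - p af) *m w af k) 0 0 ?<= if `[< part k (p af) >].
  by apply: Da; rewrite ffunE.
(* One strict inequality would make the sum of the pairings positive,
   whereas the normals of af have sum zero. *)
have part_af k : part k (p af).
  apply/asboolP/negPn/negP => npart.
  have : \sum_k ((v - p af) *m w af k) 0 0 > 0.
    rewrite (bigD1 k) //= ltr_pwDl ?sumr_ge0 //; last first.
      by move=> i _; apply: lteifW; apply: Daf.
    by have := Daf k; rewrite (negPf npart).
  by rewrite -summxE -mulmx_sumr w0 mulmx0 mxE ltxx.
suff /(congr1 val) : widen_ord le_mr (Ordinal m_gt1)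
    = widen_ord le_mr (Ordinal (ltnW m_gt1)) by [].
by apply: Qdisj => //; exists (p af); split; apply: part_af.
Qed.

End Criterion.

(** * Words as numbers in a large base *)

Section Configuration.
Variables (R : realType) (m s : nat).
Implicit Types a b : {ffun 'I_m -> 'I_s}.

(** The base is large enough for a digit, even when multiplied by 8 m, to stay
below the next power; this leaves room for the m parts and for the factors 2
that appear when squares are compared. *)
Definition scale : R := (8 * (m * s))%:R.

Definition digit a (k : 'I_m) : R := (a k)%:R * scale ^+ k.

Definition position a (n : nat) : R := \sum_(i < m | (i < n)%N) digit a i.

Lemma position0 a : position a 0 = 0.
Proof. by rewrite /position big_pred0. Qed.

Lemma positionS a (k : 'I_m) : position a k.+1 = position a k + digit a k.
Proof.
rewrite /position (bigD1 k) //= addrC; congr (_ + _).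
by apply: eq_bigl => i; rewrite ltnS ltn_neqAle andbC.
Qed.

Lemma position_total a : position a m = \sum_k digit a k.
Proof. by apply: eq_bigl => i; rewrite ltn_ord. Qed.

Lemma position_agree a b n1 n2 : (n1 <= n2)%N ->
    (forall i : 'I_m, (n1 <= i)%N -> a i = b i) ->
  position b n2 - position a n2 = position b n1 - position a n1.
Proof.
move=> le_n ab; rewrite /position -!sumrB big_mkcond [RHS]big_mkcond /=.
apply: eq_bigr => i _; case: (ltnP i n1) => [/leq_trans->//|le_n1].
by rewrite /digit ab // subrr if_same.
Qed.

Definition square_increment a (k : 'I_m) : R :=
  position a k.+1 ^+ 2 - position a k ^+ 2.

(** By this identity the sum of the m coordinates of a point is linear in its
position, so that the position is itself an affine function of the point. *)
Lemma sum_square_increment a : \sum_k square_increment a k = position a m ^+ 2.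
Proof.
rewrite -(big_mkord predT (fun k => position a k.+1 ^+ 2 - position a k ^+ 2)).
by rewrite telescope_sumr // position0 expr0n subr0.
Qed.

(** A word and a place witness that s and m are positive. *)
Lemma scale_ge1 a (k : 'I_m) : 1 <= scale.
Proof.
have s_gt0 : (0 < s)%N by apply: leq_ltn_trans (ltn_ord (a k)).
have m_gt0 : (0 < m)%N by apply: leq_ltn_trans (ltn_ord k).
by rewrite ler1n !muln_gt0 m_gt0.
Qed.

Lemma pow_scale_gt0 a (k : 'I_m) n : 0 < scale ^+ n.
Proof. by rewrite exprn_gt0 // (lt_le_trans ltr01) // (scale_ge1 a k). Qed.

Lemma digit_ge0 a k : 0 <= digit a k.
Proof. by rewrite mulr_ge0 // ltW // (pow_scale_gt0 a k). Qed.

Lemma digit_lt a (k : 'I_m) : 8 * m%:R * digit a k < scale ^+ k.+1.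
Proof.
have s_gt0 : (0 < s)%N by apply: leq_ltn_trans (ltn_ord (a k)).
have m_gt0 : (0 < m)%N by apply: leq_ltn_trans (ltn_ord k).
rewrite /digit exprS mulrA ltr_pM2r ?(pow_scale_gt0 a k) // -!natrM ltr_nat.
by rewrite -mulnA !ltn_pmul2l.
Qed.

(** Each of the at most m digits below place k is at most scale^k / (8 m). *)
Lemma position_dist a b (k : 'I_m) :
  8 * `|position b k - position a k| <= scale ^+ k.
Proof.
have m_gt0 : (0 < m)%N by apply: leq_ltn_trans (ltn_ord k).
have mR_gt0 : 0 < m%:R :> R by rewrite ltr0n.
rewrite -(ler_pM2l mR_gt0) mulrA /position -sumrB.
apply: le_trans (ler_wpM2l _ (ler_norm_sum _ _ _)) _; first by rewrite mulr_ge0.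
rewrite mulr_sumr big_mkcond /=.
have -> : m%:R * scale ^+ k = \sum_(i < m) scale ^+ k.
  by rewrite sumr_const card_ord mulr_natl.
apply: ler_sum => i _.
case: ifP => [lt_ik|_]; last by rewrite ltW // (pow_scale_gt0 a k).
have le_pow : scale ^+ i.+1 <= scale ^+ k.
  by rewrite ler_weXn2l // (scale_ge1 a k).
have := digit_lt a i; have := digit_lt b i.
have := digit_ge0 a i; have := digit_ge0 b i.
move: (digit a i) (digit b i) (scale ^+ i.+1) (scale ^+ k) le_pow => x y A B.
move=> *; suff : `|y - x| <= Num.max x y.
  move/(ler_wpM2l (ltW mR_gt0)).
  have : m%:R * Num.max x y * 8 <= B by case: (leP x y) => _; lra.
  lra.
by rewrite ler_norml; case: (leP x y) => ?; apply/andP; split; lra.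
Qed.

(** The digits at the top differing place l differ by at least scale^l, of which
the lower places can cancel at most one eighth. *)
Lemma position_gap a b (l : 'I_m) : a l != b l ->
    (forall i : 'I_m, (l < i)%N -> a i = b i) ->
  7 * scale ^+ l <= 8 * `|position b m - position a m|.
Proof.
move=> ab_l /(position_agree a b _ m (ltn_ord l)) ->; rewrite !positionS.
have pow_gt0 := pow_scale_gt0 a l l.
have hdigit : scale ^+ l <= `|digit b l - digit a l|.
  rewrite /digit -mulrBl normrM (gtr0_norm pow_gt0) (ler_peMl (ltW pow_gt0)) //.
  case: (ltngtP (a l) (b l)) => [||/val_inj eq_l].
  - rewrite -(ler_nat R) -natr1 => ?; apply: le_trans (ler_norm _); lra.
  - rewrite -(ler_nat R) -natr1 => ?; rewrite distrC.
    by apply: le_trans (ler_norm _); lra.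
  - by rewrite eq_l eqxx in ab_l.
have hdist := position_dist a b l.
set E := position b l - _ in hdist; set T := digit b l - _ in hdigit.
have -> : position b l + digit b l - (position a l + digit a l) = T + E.
  by rewrite /T /E; ring.
have := ler_normB (T + E) E; rewrite addrK.
lra.
Qed.

Lemma top_difference a b : a != b ->
  exists2 l, a l != b l & forall i : 'I_m, (l < i)%N -> a i = b i.
Proof.
move=> ab.
have /existsP[l0 hl0] : [exists l, a l != b l].
  apply: contraNT ab => /existsPn ab; apply/eqP/ffunP => l.
  exact/eqP/negPn/ab.
case: (@arg_maxnP _ l0 (fun l => a l != b l) (@nat_of_ord m) hl0) => l ab_l lmax.
exists l => // i.
by apply: contraTeq => /lmax; rewrite -leqNgt.
Qed.

Lemma position_inj a b : position a m = position b m -> a = b.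
Proof.
move=> eq_pos; apply/eqP; apply: contraT => /top_difference[l ab_l above].
have pow_gt0 := pow_scale_gt0 a l l.
have := position_gap a b l ab_l above.
by rewrite eq_pos subrr normr0; lra.
Qed.

(** In b this is a combination of 1, of the position and of its square minus m
times the k-th square increment, which makes it affine on the points below.
Over k, the subtracted remainders add up to m times the squared difference of
positions, because the increments add up to a square and the digits to its
root; hence these functions add up to zero. *)
Definition separation a b (k : 'I_m) : R :=
  (position b m - position a m) ^+ 2
  - m%:R * (square_increment b k - square_increment a k
            - 2 * digit a k * (position b m - position a m)).

(** Agreement at place k turns the second term of the separation into
2 m t (D - E), where t is the common digit, D the difference of the positions
and E that of their parts below k.  If the top differing place is below k then
D = E; otherwise |D| exceeds both |E| and m t by enough for D^2 to dominate. *)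
Lemma separation_gt0 a b k : b k = a k -> b != a -> 0 < separation a b k.
Proof.
move=> ba_k neq_ba.
have sepE : separation a b k = (position b m - position a m) ^+ 2
    + 2 * (m%:R * digit a k) * ((position b m - position a m)
                                - (position b k - position a k)).
  have eq_digit : digit b k = digit a k by rewrite /digit ba_k.
  by rewrite /separation /square_increment !positionS eq_digit; ring.
rewrite {}sepE.
have [|l ab_l above] := top_difference a b; first by rewrite eq_sym.
have [lt_lk|] := ltnP l k.
  have <- : position b m - position a m = position b k - position a k.
    apply: position_agree; first exact: ltnW (ltn_ord k).
    by move=> i /(leq_trans lt_lk)/above.
  rewrite subrr mulr0 addr0 exprn_even_gt0 //= subr_eq0; apply: contra neq_ba => /eqP.
  by move/position_inj->.
rewrite leq_eqVlt => /predU1P[/val_inj kl|lt_kl].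
  by rewrite -kl ba_k eqxx in ab_l.
have pow_gt0 := pow_scale_gt0 a l l.
have scale_ge1 := scale_ge1 a l.
have hdigit : 8 * (m%:R * digit a k) < scale ^+ l.
  by rewrite mulrA (lt_le_trans (digit_lt a k)) // ler_weXn2l.
have hdigit0 : 0 <= m%:R * digit a k by rewrite mulr_ge0 // digit_ge0.
have hlow : 8 * `|position b k - position a k| <= scale ^+ l.
  by rewrite (le_trans (position_dist a b k)) // ler_weXn2l // ltnW.
have hgap := position_gap a b l ab_l above.
move: (position b m - _) (position b k - _) (m%:R * _) (scale ^+ l)
  hdigit hdigit0 hlow hgap pow_gt0 => D E t S ht t0 hE hD S0.
have DE : - (2 * `|D|) <= D - E.
  have := ler_normD D (- E); have := ler_norm (- (D - E)).
  by rewrite !normrN; lra.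
rewrite -real_normK ?num_real //; move: `|D| hD DE => u hu DE.
have : 2 * t * - (2 * u) <= 2 * t * (D - E) by rewrite ler_wpM2l //; lra.
by nra.
Qed.
End Configuration.

(** * The points and their normals *)

Section Embedding.
Variables (R : realType) (m s d : nat) (le_md : (m <= d)%N).
Implicit Types a b : {ffun 'I_m -> 'I_s}.

Definition point a : 'rV[R]_d :=
  \row_(j < d) (if insub (val j) is Some k
                then position R m s a m + position R m s a m ^+ 2
                     - m%:R * square_increment R m s a k
                else 0).

Definition axis (k : 'I_m) : 'cV[R]_d := delta_mx (widen_ord le_md k) 0.

(** The coefficient of the position of b in [separation] a b k, once the
squares in b are set apart, is the opposite of this number. *)
Definition slope a (k : 'I_m) : R :=
  2 * (position R m s a m - m%:R * digit R m s a k).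

Definition normal a (k : 'I_m) : 'cV[R]_d :=
  m%:R *: axis k - (1 + slope a k) *: \sum_i axis i.

Lemma sum_slope a : \sum_k slope a k = 0.
Proof.
rewrite -mulr_sumr sumrB sumr_const card_ord -mulr_sumr -position_total.
by rewrite -[_ *+ m]mulr_natl subrr mulr0.
Qed.

(** The m axes cancel against m copies of their sum, since the slopes add up
to zero. *)
Lemma sum_normal a : \sum_k normal a k = 0.
Proof.
rewrite sumrB -scaler_sumr -scaler_suml big_split /= sumr_const card_ord.
by rewrite sum_slope addr0 subrr.
Qed.

Lemma point_axis a k : (point a *m axis k) 0 0 =
  position R m s a m + position R m s a m ^+ 2
  - m%:R * square_increment R m s a k.
Proof. by rewrite -colE !mxE /= valK. Qed.

Lemma sum_point_axis a :
  \sum_k (point a *m axis k) 0 0 = m%:R * position R m s a m.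
Proof.
under eq_bigr do rewrite point_axis.
rewrite sumrB sumr_const card_ord -mulr_sumr sum_square_increment -mulr_natl.
by ring.
Qed.

(** The sum of the axes reads m times the position off a point, and subtracting
it from m times the k-th axis removes the linear term of the coordinate. *)
Lemma point_normal a b k :
  ((point b - point a) *m normal a k) 0 0 = m%:R * separation R m s a b k.
Proof.
have pairing c : (point c *m normal a k) 0 0 =
    m%:R * (position R m s c m ^+ 2 - m%:R * square_increment R m s c k
            - slope a k * position R m s c m).
  have entry (A B : 'M[R]_1) x y :
      (x *: A - y *: B) 0 0 = x * A 0 0 - y * B 0 0 by rewrite !mxE.
  rewrite mulmxBr -!scalemxAr mulmx_sumr entry summxE sum_point_axis.
  by rewrite point_axis; ring.
have -> : ((point b - point a) *m normal a k) 0 0 =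
    (point b *m normal a k) 0 0 - (point a *m normal a k) 0 0.
  by rewrite mulmxBl [LHS]mxE [X in _ + X]mxE.
by rewrite !pairing /separation /slope; ring.
Qed.

Lemma point_inj : (0 < m)%N -> injective point.
Proof.
move=> m_gt0 a b eq_p; apply: (position_inj R).
have mR_neq0 : m%:R != 0 :> R by rewrite pnatr_eq0 -lt0n.
by apply: (mulfI mR_neq0); rewrite -!sum_point_axis eq_p.
Qed.

End Embedding.

Theorem theorem1p3 (R : realType) (r s d : nat)
    (hr : (2 <= r)%N) (hs : (1 <= s)%N) (hd : (2 <= d)%N) :
  (((s ^ minn r d)%N)%:R%:E < s_convex_tverberg R d (fun _ : 'I_r => s))%E.
Proof.
set m := minn r d.
have m_gt1 : (1 < m)%N by rewrite leq_min hr.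
have m_gt0 := ltnW m_gt1.
have le_md : (m <= d)%N := geq_minr r d.
have le_mr : (m <= r)%N := geq_minl r d.
pose P := [fset point R m s d a | a : {ffun 'I_m -> 'I_s}]%fset.
have cardP : #|` P| = (s ^ m)%N.
  rewrite card_imfset; last exact: point_inj.
  by rewrite -cardE card_ffun !card_ord.
have noP : ~ s_convex_tverberg_partition (fun _ : 'I_r => s) P.
  apply: (@no_tverberg_partition_of_normals R r s d m (point R m s d)
            (normal R m s d le_md)) => //.
  - by move=> v /imfsetP[a _ ->]; exists a.
  - exact: sum_normal.
  - move=> a b k ba_k neq_ba; rewrite point_normal mulr_gt0 ?ltr0n //.
    exact: separation_gt0.
apply: (@lt_le_trans _ _ ((s ^ m).+1%:R%:E)).
  by rewrite lte_fin ltr_nat.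
apply: le_ereal_inf_tmp => _ [N hN <-]; rewrite lee_fin ler_nat ltnNge.
by apply/negP => le_N; apply: noP; apply: hN; rewrite cardP.
Qed.
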